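(* Let $n\ge1$, $\nu\ge1$ be integers and $\delta\in\{0,1,2\}$. The graph $\mathcal{O}^{(2\nu+\delta)}_{2^n}$ is $2^{n(2\nu+\delta-2)}$-regular on $2^{(n-1)(2\nu+\delta-2)}(2^\nu-1)(2^{\nu+\delta-1}+1)$ vertices. Moreover: (1) If $\nu=1$, then it is a strongly regular graph in which every pair of adjacent vertices has $\lambda=2^{\delta n}-2^{\delta(n-1)}$ common neighbours and every pair of non-adjacent vertices has $\mu=\lceil\delta/2\rceil 2^{\delta n}$ common neighbours. (2) If $\nu\ge2$, then it is a quasi-strongly regular graph in which every pair of adjacent vertices has $\lambda=2^{n-1}\big(2^{n(\nu+\frac{\delta}{2}-1)}+(\delta-1)2^{(n-1)(\nu+\frac{\delta}{2}-1)}\big)2^{n(\nu-2+\frac{\delta}{2})}$ common neighbours and every pair of non-adjacent vertices has either $c_1=2^{n-1}2^{n(2\nu-3+\delta)}$ or $c_2=2^{n(2\nu-2+\delta)}$ common neighbours.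
   Context: Let $V^{2\nu+\delta}$ be the set of tuples $\vec a=(a_1,\ldots,a_{2\nu+\delta})\in(\mathbb{Z}_{2^n})^{2\nu+\delta}$ such that some $a_i$ is a unit of $\mathbb{Z}_{2^n}$. Write $\vec a\sim\vec b$ if $\vec a=\lambda\vec b$ for some $\lambda\in\mathbb{Z}_{2^n}^\times$, let $[\vec a]$ denote the equivalence class and $V^{2\nu+\delta}_\sim$ the set of classes. Let $G_{2\nu+\delta,\Delta}=\begin{pmatrix}0&I_\nu&\\ &0&\\ &&\Delta\end{pmatrix}$ over $\mathbb{Z}_{2^n}$ (first two block sizes $\nu$, unspecified blocks zero), where $\Delta$ is empty if $\delta=0$, $\Delta=(1)$ if $\delta=1$, and $\Delta=\begin{pmatrix}z&1\\0&z\end{pmatrix}$ if $\delta=2$, with $z$ a fixed unit of $\mathbb{Z}_{2^n}$. The orthogonal graph $\mathcal{O}^{(2\nu+\delta)}_{2^n}$ has vertex set $\{[\vec a]\in V^{2\nu+\delta}_\sim:\vec a\,G_{2\nu+\delta,\Delta}\,\vec a^t=0\}$, with $[\vec a]$ adjacent to $[\vec b]$ iff $\vec a(G_{2\nu+\delta,\Delta}+G_{2\nu+\delta,\Delta}^t)\vec b^t\in\mathbb{Z}_{2^n}^\times$. A quasi-strongly regular graph with parameters $(v,k,\lambda,\{c_1,\ldots,c_d\})$ is a $k$-regular graph on $v$ vertices in which every pair of adjacent vertices has $\lambda$ common neighbours and every pair of non-adjacent vertices has one of $c_1,\ldots,c_d$ common neighbours, for some $d\ge2$. *)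

(* Defs.v *)
From HB Require Import structures.
From mathcomp Require Import all_boot all_order all_algebra all_field.
Set Implicit Arguments. Unset Strict Implicit. Unset Printing Implicit Defensive.
Import Order.TTheory GRing.Theory Num.Theory.
Local Open Scope ring_scope.

Section OrthGraph.
Variable R : finComUnitRingType.

(* The block Delta: empty (delta = 0), (1) (delta = 1), [[z,1],[0,z]] (delta = 2). *)
Definition Delta (delta : nat) (z : R) (a b : nat) : R :=
  if delta == 1%N then (if (a == 0%N) && (b == 0%N) then 1 else 0)
  else if delta == 2%N then
    (if a == b then z else if (a == 0%N) && (b == 1%N) then 1 else 0)
  else 0.

(* G_{2nu+delta,Delta} = [[0, I_nu, ], [ , 0, ], [ , , Delta]] *)
Definition Gmat (nu delta : nat) (z : R) : 'M[R]_(2 * nu + delta) :=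
  \matrix_(i, j)
    (if ((i < nu)%N && ((j : nat) == (i : nat) + nu)%N) then 1
     else if ((2 * nu <= i)%N && (2 * nu <= j)%N)
          then Delta delta z ((i : nat) - 2 * nu)%N ((j : nat) - 2 * nu)%N
          else 0).

Variable m : nat.

Definition admissible (a : 'rV[R]_m) : bool := [exists i, a 0 i \is a GRing.unit].

Definition qform (G : 'M[R]_m) (a : 'rV[R]_m) : R := (a *m G *m a^T) 0 0.
Definition bform (G : 'M[R]_m) (a b : 'rV[R]_m) : R := (a *m (G + G^T) *m b^T) 0 0.

Definition cls (a : 'rV[R]_m) : {set 'rV[R]_m} :=
  [set b | [exists l : R, (l \is a GRing.unit) && (b == l *: a)]].

Definition vertices (G : 'M[R]_m) : {set {set 'rV[R]_m}} :=
  [set cls a | a : 'rV[R]_m & admissible a && (qform G a == 0)].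

Definition adj (G : 'M[R]_m) (X Y : {set 'rV[R]_m}) : bool :=
  [exists a in X, exists b in Y, bform G a b \is a GRing.unit].
End OrthGraph.

Section GraphNotions.
Variable T : finType.
Variables (V : {set T}) (e : rel T).

Definition regular (k : nat) : Prop :=
  forall x, x \in V -> #|[set y in V | e x y]| = k.

Definition common (x y : T) : nat := #|[set w in V | e x w && e y w]|.

Definition strongly_regular (v k lam mu : nat) : Prop :=
  [/\ #|V| = v, regular k,
      (forall x y, x \in V -> y \in V -> x != y -> e x y -> common x y = lam) &
      (forall x y, x \in V -> y \in V -> x != y -> ~~ e x y -> common x y = mu)].

Definition quasi_strongly_regular (v k lam : nat) (cs : seq nat) : Prop :=
  [/\ #|V| = v, regular k,
      (forall x y, x \in V -> y \in V -> x != y -> e x y -> common x y = lam),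
      (2 <= size cs)%N &
      (forall x y, x \in V -> y \in V -> x != y -> ~~ e x y -> common x y \in cs)].
End GraphNotions.

(* Main.v *)
Require Import Defs.
From HB Require Import structures.
From mathcomp Require Import all_boot all_order all_algebra all_field.
From mathcomp Require Import ring zify.
Import Order.TTheory GRing.Theory Num.Theory.
Local Open Scope ring_scope.

(* Adjacency only depends on residues mod 2, so the graph is a blow-up of the
   binary (n = 1) orthogonal graph: by Hensel's lemma every zero of the binary
   quadratic form lifts to 2^((n-1)(2 nu + delta - 2)) classes. Over F_2, write
   the indicator of a vector being singular, or non-orthogonal to a given one,
   through signs (-1)^x. Since q(p + r) = q(r) + b(p,r) for singular p, the
   twisted sums of (-1)^(q(r) + b(p,r)) all equal the Gauss sum
   2^nu (2 - 2^delta) up to sign, which yields all the intersection numbers. *)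

(** * Quadratic forms and sign sums over F_2 *)

Section FormTheory.
Variables (R : finComUnitRingType) (m : nat).
Implicit Types (G : 'M[R]_m) (a b c : 'rV[R]_m).

Lemma bformE G a b :
  bform G a b = (a *m G *m b^T) 0 0 + (b *m G *m a^T) 0 0.
Proof.
rewrite /bform mulmxDr mulmxDl mxE; congr (_ + _).
by rewrite -[a *m G^T *m b^T]trmxK mxE !trmx_mul !trmxK mulmxA.
Qed.

Lemma bformC G a b : bform G a b = bform G b a.
Proof. by rewrite !bformE addrC. Qed.

Lemma bformDl G a b c : bform G (a + b) c = bform G a c + bform G b c.
Proof. by rewrite /bform !mulmxDl mxE. Qed.

Lemma bformDr G a b c : bform G a (b + c) = bform G a b + bform G a c.
Proof. by rewrite bformC bformDl !(bformC G a). Qed.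

Lemma bformZr G l a b : bform G a (l *: b) = l * bform G a b.
Proof. by rewrite /bform linearZ -scalemxAr mxE. Qed.

Lemma bform0r G a : bform G a 0 = 0.
Proof. by rewrite /bform trmx0 mulmx0 mxE. Qed.

Lemma bform_diag G a : bform G a a = qform G a *+ 2.
Proof. by rewrite bformE mulr2n. Qed.

Lemma qformD G a b : qform G (a + b) = qform G a + qform G b + bform G a b.
Proof.
rewrite bformE /qform linearD /= !mulmxDl !mulmxDr !mxE.
ring.
Qed.

Lemma qformZ G l a : qform G (l *: a) = l ^+ 2 * qform G a.
Proof. by rewrite /qform linearZ /= -!scalemxAl -scalemxAr scalerA mxE expr2. Qed.

End FormTheory.

Section Reduction.
Variables (R S : finComUnitRingType) (f : {rmorphism R -> S}) (m : nat).
Variables (G : 'M[R]_m) (a b : 'rV[R]_m).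

Lemma qform_map : qform (map_mx f G) (map_mx f a) = f (qform G a).
Proof. by rewrite /qform map_trmx -!map_mxM mxE. Qed.

Lemma bform_map : bform (map_mx f G) (map_mx f a) (map_mx f b) = f (bform G a b).
Proof. by rewrite /bform !map_trmx -map_mxD -!map_mxM mxE. Qed.

End Reduction.

(** The nontrivial additive character of F_2, valued in the integers so that counts can be read off
    from sums of its values. *)
Definition F2_sign (x : 'F_2) : int := if x == 0 then 1 else -1.

Lemma F2P (x : 'F_2) : x = 0 \/ x = 1.
Proof. by case: x => -[|[|//]] lt; [left|right]; apply/val_inj. Qed.

Lemma F2_addxx (x : 'F_2) : x + x = 0.
Proof. by case: (F2P x) => ->; apply/val_inj. Qed.

Lemma F2_neq0 (x : 'F_2) : (x != 0) = (x == 1).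
Proof. by case: (F2P x) => ->. Qed.

Lemma F2_signD x y : F2_sign (x + y) = F2_sign x * F2_sign y.
Proof. by case: (F2P x) => ->; case: (F2P y) => ->. Qed.

Lemma F2_sign_sqr x : F2_sign x * F2_sign x = 1.
Proof. by case: (F2P x) => ->. Qed.

Lemma F2_eq0_sign x : 2 * (x == 0)%:R = 1 + F2_sign x.
Proof. by case: (F2P x) => ->. Qed.

Lemma F2_indicator2_sign x y : 4 * ((x == 0) && (y != 0))%:R
  = 1 - F2_sign y + F2_sign x - F2_sign x * F2_sign y.
Proof. by case: (F2P x) => ->; case: (F2P y) => ->. Qed.

(** Writing s for the sign, this expands (1 + s(x))(1 - s(y))(1 - s(z)). The product s(y)s(z) is
    kept as s(y + z), ready for b(p,r) + b(p',r) = b(p + p',r). *)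
Lemma F2_indicator3_sign x y z : 8 * ((x == 0) && ((y != 0) && (z != 0)))%:R
  = 1 - F2_sign y - F2_sign z + F2_sign (y + z)
    + F2_sign x - F2_sign x * F2_sign y - F2_sign x * F2_sign z
    + F2_sign x * F2_sign (y + z).
Proof. by case: (F2P x) => ->; case: (F2P y) => ->; case: (F2P z) => ->. Qed.

Lemma F2_rV_addxx m (p : 'rV['F_2]_m) : p + p = 0.
Proof. by apply/rowP=> i; rewrite !mxE F2_addxx. Qed.

Lemma card_F2_rV m : #|{: 'rV['F_2]_m}| = (2 ^ m)%N.
Proof. by rewrite card_mx card_ord mul1n. Qed.

Lemma setI_sep (T : finType) (P Q S : pred T) :
  [set x | P x && Q x] :&: [set x | P x && S x] = [set x | P x && (Q x && S x)].
Proof. by apply/setP=> x; rewrite !inE andbACA andbb. Qed.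

Lemma card_sum_int (T : finType) (P : pred T) :
  #|[set x | P x]|%:R = \sum_x ((P x)%:R : int).
Proof.
rewrite -sum1dep_card natr_sum big_mkcond.
by apply: eq_bigr => x _; case: (P x).
Qed.

(** Translation by [y] permutes the vectors and flips the sign of every term, so the sum equals its
    own opposite. *)
Lemma sum_F2_sign_morph m (f : 'rV['F_2]_m -> 'F_2) y :
  {morph f : r s / r + s} -> f y != 0 -> \sum_r F2_sign (f r) = 0.
Proof.
move=> fD fy; set s := \sum_r _.
suff: s = - s by lia.
rewrite {1}/s (reindex_inj (addIr y)) -sumrN; apply: eq_bigr => r _.
by rewrite fD F2_signD [F2_sign (f y)]/F2_sign (negbTE fy) mulrN1.
Qed.

Lemma card_indicator2 (T : finType) (x y : T -> 'F_2) (sx sxy : int) :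
    \sum_r F2_sign (y r) = 0 -> \sum_r F2_sign (x r) = sx ->
    \sum_r F2_sign (x r) * F2_sign (y r) = sxy ->
  4%Z * #|[set r | (x r == 0) && (y r != 0)]|%:R = #|T|%:R + sx - sxy.
Proof.
move=> y0 <- <-; rewrite card_sum_int mulr_sumr.
under eq_bigr do rewrite F2_indicator2_sign.
by rewrite !big_split /= !sumrN y0 sumr_const oppr0 addr0.
Qed.

Lemma card_indicator3 (T : finType) (x y z : T -> 'F_2) (sx sxy sxz sxyz : int) :
    \sum_r F2_sign (y r) = 0 -> \sum_r F2_sign (z r) = 0 ->
    \sum_r F2_sign (y r + z r) = 0 -> \sum_r F2_sign (x r) = sx ->
    \sum_r F2_sign (x r) * F2_sign (y r) = sxy ->
    \sum_r F2_sign (x r) * F2_sign (z r) = sxz ->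
    \sum_r F2_sign (x r) * F2_sign (y r + z r) = sxyz ->
  8%Z * #|[set r | (x r == 0) && ((y r != 0) && (z r != 0))]|%:R
    = #|T|%:R + sx - sxy - sxz + sxyz.
Proof.
move=> y0 z0 yz0 <- <- <- <-; rewrite card_sum_int mulr_sumr.
under eq_bigr do rewrite F2_indicator3_sign.
by rewrite !big_split /= !sumrN y0 z0 yz0 sumr_const !oppr0 !addr0.
Qed.

(** * Singular vectors of a binary quadratic form *)

Section BinaryQuadric.
Variables (m : nat) (H : 'M['F_2]_m).
Local Notation q := (qform H).
Local Notation b := (bform H).

Definition gauss_sum : int := \sum_r F2_sign (q r).

Definition zeros_nonorth (p : 'rV['F_2]_m) :=
  [set r | (q r == 0) && (b p r != 0)].

(** Only singular vectors are kept out of the radical of b: for [delta = 1] the last basis vector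
    lies in the radical in characteristic 2, but q takes the value 1 on it. *)
Definition nonsingular_form :=
  forall p : 'rV['F_2]_m, p != 0 -> q p = 0 -> exists y, b p y != 0.

Lemma sum_F2_sign_bform p y :
  b p y != 0 -> \sum_r F2_sign (b p r) = 0.
Proof. exact/sum_F2_sign_morph/bformDr. Qed.

(** Substitute r by p + r in the Gauss sum. Here [p] is arbitrary, because the count for two vectors
    applies this to p + p', where q(p + p') = b(p,p'). *)
Lemma sum_F2_sign_qform_bform p :
  \sum_r F2_sign (q r) * F2_sign (b p r) = F2_sign (q p) * gauss_sum.
Proof.
rewrite /gauss_sum [in RHS](reindex_inj (addrI p)) mulr_sumr; apply: eq_bigr => r _.
by rewrite qformD !F2_signD !mulrA F2_sign_sqr mul1r.
Qed.

Lemma sum_F2_rV_const : \sum_(r : 'rV['F_2]_m) (1 : int) = 2 ^+ m.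
Proof. by rewrite sumr_const -[#|_|]/#|{: 'rV['F_2]_m}| card_F2_rV natrX. Qed.

Lemma card_zeros : 2 * #|[set r | q r == 0]|%:R = 2 ^+ m + gauss_sum.
Proof.
rewrite card_sum_int mulr_sumr /gauss_sum -sum_F2_rV_const -big_split /=.
by apply: eq_bigr => r _; apply: F2_eq0_sign.
Qed.

(** As [p] is singular, the plain and the twisted Gauss sums are equal and cancel. *)
Lemma card_zeros_nonorth p y : q p = 0 -> b p y != 0 ->
  4%Z * #|zeros_nonorth p|%:R = 2 ^+ m.
Proof.
move=> qp py.
rewrite (card_indicator2 _ q (b p) gauss_sum gauss_sum) ?(sum_F2_sign_bform _ _ py) //.
  by rewrite card_F2_rV addrK natrX.
by rewrite sum_F2_sign_qform_bform qp mul1r.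
Qed.

Lemma card_zeros_nonorth2 (p p' : 'rV['F_2]_m) : nonsingular_form ->
    p != 0 -> p' != 0 -> p != p' -> q p = 0 -> q p' = 0 ->
  8 * #|zeros_nonorth p :&: zeros_nonorth p'|%:R
    = 2 ^+ m - gauss_sum + F2_sign (b p p') * gauss_sum.
Proof.
move=> nsH p0 p'0 pp' qp qp'.
have [y py] := nsH _ p0 qp; have [y' py'] := nsH _ p'0 qp'.
have qD : q (p + p') = b p p' by rewrite qformD qp qp' !add0r.
(* If b(p,p') is nonzero, p' itself is a witness; otherwise p + p' is a nonzero singular vector and
   nonsingularity applies. *)
have [y'' py''] : exists y, b (p + p') y != 0.
  have [bpp|bpp] := eqVneq (b p p') 0; last first.
    by exists p'; rewrite bformDl bform_diag qp' mul0rn addr0.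
  apply: nsH; last by rewrite qD.
  apply: contraNneq pp' => pp0.
  by rewrite -(addr0 p) -(F2_rV_addxx _ p') addrA pp0 add0r.
rewrite [zeros_nonorth p :&: _]setI_sep.
have bD r : b p r + b p' r = b (p + p') r by rewrite bformDl.
have := card_indicator3 _ q (b p) (b p') gauss_sum (F2_sign (q p) * gauss_sum)
  (F2_sign (q p') * gauss_sum) (F2_sign (q (p + p')) * gauss_sum)
  (sum_F2_sign_bform _ _ py) (sum_F2_sign_bform _ _ py').
rewrite (eq_bigr _ (fun r _ => congr1 F2_sign (bD r))).
rewrite [X in _ -> _ -> _ -> _ -> X = _ -> _](eq_bigr _
  (fun r _ => congr1 (fun t => F2_sign (q r) * F2_sign t) (bD r))).
move/(_ (sum_F2_sign_bform _ _ py'') erefl (sum_F2_sign_qform_bform _)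
  (sum_F2_sign_qform_bform _) (sum_F2_sign_qform_bform _)) => ->.
rewrite card_F2_rV natrX qp qp' qD [F2_sign 0]/F2_sign eqxx.
by move: gauss_sum (F2_sign _) => g t; ring.
Qed.

End BinaryQuadric.

(** * Lifting from the residue field *)

Section ResidueF2.
Variables (R : finComUnitRingType) (rho : {rmorphism R -> 'F_2}).
Hypothesis unit_res : forall x, (x \is a GRing.unit) = (rho x != 0).
Local Notation red := (map_mx rho).

(** By [unit_res] this kernel is the set of non-units, so [R] is local with residue field F_2. *)
Definition max_ideal : {set R} := [set x | rho x == 0].

Lemma res_lift_bool (x : 'F_2) : rho (x != 0)%:R = x.
Proof. by case: (F2P x) => ->; rewrite ?rmorph0 ?rmorph1. Qed.

Lemma red_lift_bool m (p : 'rV['F_2]_m) : red (\row_j (p 0 j != 0)%:R) = p.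
Proof. by apply/rowP=> j; rewrite !mxE res_lift_bool. Qed.

(** The residue field has a single nonzero element, so the units form the coset 1 + [max_ideal]. *)
Lemma card_units : #|[set x : R | x \is a GRing.unit]| = #|max_ideal|.
Proof.
rewrite -[in RHS](card_imset _ (addrI 1)); apply: eq_card => x; rewrite in_set unit_res.
apply/idP/imsetP=> [nx|[y]].
  exists (x - 1); last by rewrite addrC subrK.
  rewrite inE rmorphB rmorph1 subr_eq0 -F2_neq0 //.
by rewrite inE => /eqP y0 ->; rewrite rmorphD rmorph1 y0 addr0.
Qed.

Lemma card_max_ideal : (2 * #|max_ideal|)%N = #|R|.
Proof.
rewrite mul2n -addnn -{1}card_units -(cardsC max_ideal) addnC; congr addn.
by apply: eq_card => x; rewrite !in_set unit_res.
Qed.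

Section Fibers.
Variable m : nat.
Implicit Types (p : 'rV['F_2]_m) (a : 'rV[R]_m).

(** Reduction is a surjective group morphism, so its 2^m fibres are translates of one another; [t]
    below is a lift of r - p with entries 0 and 1. *)
Lemma card_red_fiber p : (2 ^ m * #|[set a | red a == p]|)%N = (#|R| ^ m)%N.
Proof.
rewrite -[in RHS](mul1n m) -card_mx -[in RHS]sum1_card.
rewrite [RHS](partition_big red xpredT) //= -card_F2_rV -sum_nat_const.
apply: eq_bigr => r _; rewrite sum1dep_card.
pose t : 'rV[R]_m := \row_j ((r - p) 0 j != 0)%:R.
have redt : red t = r - p by apply: red_lift_bool.
rewrite -[in LHS](card_imset _ (addrI t)); apply: eq_card => a; rewrite [in RHS]inE.
apply/imsetP/eqP=> [[c]|ar].
  by rewrite inE => /eqP cp ->; rewrite map_mxD redt cp subrK.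
exists (a - t); last by rewrite addrC subrK.
by rewrite inE map_mxB redt ar opprB addrC subrK.
Qed.

Variable G : 'M[R]_m.

(* Hensel's lemma on the line c + t y: its derivative B(c,y) in t is a unit. *)
Lemma card_zeros_line c y : rho (qform G c) = 0 -> rho (bform G c y) != 0 ->
  #|[set t in max_ideal | qform G (c + t *: y) == 0]| = 1%N.
Proof.
move=> qc cy.
pose g t := qform G (c + t *: y).
have gE t : g t = qform G c + t ^+ 2 * qform G y + t * bform G c y.
  by rewrite /g qformD qformZ bformZr.
have g_inj : {in max_ideal &, injective g}.
  move=> t u; rewrite !inE => /eqP t0 /eqP u0; rewrite !gE => /eqP.
  (* The difference quotient of [g] is congruent to B(c,y) modulo the maximal ideal, hence a
     unit. *)
  rewrite -subr_eq0 (_ : _ - _ =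
     (t - u) * (bform G c y + (t + u) * qform G y)); last by ring.
  have : bform G c y + (t + u) * qform G y \is a GRing.unit.
    by rewrite unit_res rmorphD rmorphM (rmorphD rho t u) t0 u0 add0r mul0r addr0.
  by move=> w /eqP E; apply/eqP; rewrite -subr_eq0 -(mulrK w (t - u)) E mul0r.
(* An injective self-map of a finite set is onto; this takes the place of successive
   approximation. *)
have gI : g @: max_ideal = max_ideal.
  apply/eqP; rewrite eqEcard card_in_imset // leqnn andbT.
  apply/subsetP=> _ /imsetP[t + ->]; rewrite !inE gE => /eqP t0.
  by rewrite !rmorphD !rmorphM t0 qc !mul0r !addr0.
have /imsetP[t tI gt] : 0 \in g @: max_ideal by rewrite gI inE rmorph0.
apply/eqP/cards1P; exists t; apply/setP=> u; rewrite !inE.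
apply/andP/eqP=> [[uI /eqP gu]|->].
  by apply: g_inj; rewrite // ?[in u \in _]inE //; apply: etrans gu gt.
by rewrite -/(g t) -gt; split=> //; move: tI; rewrite inE.
Qed.

(** Double counting of the pairs (c, t) with c above [p], t in [max_ideal] and c + t y a zero. Each
    c admits exactly one t, and for each t the suitable c form a translate of the zeros above
    [p]. *)
Lemma card_zeros_fiber p : qform (red G) p = 0 ->
    (exists y, bform (red G) p y != 0) ->
  (#|max_ideal| * #|[set a | (red a == p) && (qform G a == 0%R)]|
     = #|[set a | red a == p]|)%N.
Proof.
move=> qp [y' py'].
pose y : 'rV[R]_m := \row_j (y' 0 j != 0)%:R.
have redy : red y = y' by apply: red_lift_bool.
rewrite -[RHS]sum1_card.
under [RHS]eq_bigr => c.
  rewrite inE => /eqP cp.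
  rewrite -(@card_zeros_line c y); first last.
  - by rewrite -bform_map cp redy.
  - by rewrite -qform_map cp.
  rewrite -sum1dep_card; over.
rewrite /= (exchange_big_dep (mem max_ideal)) /=; last by move=> c t _ /andP[].
rewrite -sum_nat_const; apply: eq_bigr => t tI.
rewrite sum1dep_card -[in RHS](card_imset _ (addIr (t *: y))).
have rt : rho t = 0 by move: tI; rewrite inE => /eqP.
have redD a : red (a + t *: y) = red a.
  by rewrite map_mxD map_mxZ rt scale0r addr0.
apply: eq_card => a; rewrite [in LHS]inE.
apply/andP/imsetP => [[/eqP ap qa]|[c + ->]].
  exists (a - t *: y); last by rewrite subrK.
  by rewrite !inE -(redD (a - _)) subrK ap rt !eqxx qa.
by rewrite inE redD => /andP[+ /andP[_ ->]]; rewrite inE => ->.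
Qed.
End Fibers.

(** * Classes of vectors and counts of vertices *)

Section Classes.
Variables (m : nat) (G : 'M[R]_m).
Implicit Types (a b : 'rV[R]_m) (p : 'rV['F_2]_m).

Lemma clsP a b :
  reflect (exists2 l, l \is a GRing.unit & b = l *: a) (b \in cls a).
Proof.
rewrite inE; apply: (iffP existsP) => [[l /andP[ul /eqP ->]]|[l ul ->]].
  by exists l.
by exists l; rewrite ul eqxx.
Qed.

Lemma cls_refl a : a \in cls a.
Proof. by apply/clsP; exists 1; rewrite ?unitr1 ?scale1r. Qed.

Lemma cls_eq a b : b \in cls a -> cls b = cls a.
Proof.
case/clsP=> l ul ->; apply/setP=> c; apply/clsP/clsP=> -[k uk ->].
  by exists (k * l); rewrite ?unitrM ?uk ?ul ?scalerA.
by exists (k / l); rewrite ?unitrM ?unitrV ?uk ?ul // scalerA divrK.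
Qed.

Lemma red_cls a b : b \in cls a -> red b = red a.
Proof.
case/clsP=> l; rewrite unit_res F2_neq0 => /eqP l1 ->.
by rewrite map_mxZ l1 scale1r.
Qed.

Lemma admissibleE a : admissible a = (red a != 0).
Proof.
apply/existsP/idP=> [[i]|].
  rewrite unit_res; apply: contraNneq => /matrixP/(_ 0 i).
  by rewrite !mxE => ->.
move=> a0; apply/existsP; apply: contraNT a0; rewrite negb_exists => /forallP a0.
apply/eqP/rowP=> i; apply/eqP; move: (a0 i).
by rewrite unit_res negbK !mxE.
Qed.

(** Some coordinate of [a] is a unit, so distinct unit multiples of [a] are distinct vectors. *)
Lemma card_cls a : admissible a -> #|cls a| = #|max_ideal|.
Proof.
case/existsP=> i ui; rewrite -card_units.
rewrite -(card_imset (f := fun l => l *: a)); last first.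
  by move=> l k /rowP/(_ i); rewrite !mxE; apply: mulIr.
apply: eq_card => b; apply/clsP/imsetP=> -[l ul ->]; exists l => //.
  by rewrite in_set.
by rewrite in_set in ul.
Qed.

Lemma adj_cls a b : adj G (cls a) (cls b) = (bform (red G) (red a) (red b) != 0).
Proof.
rewrite bform_map -unit_res; apply/existsP/idP => [[c /andP[ac /existsP[d]]]|u].
  by case/andP=> bd; rewrite !unit_res -!bform_map (red_cls _ _ ac) (red_cls _ _ bd).
by exists a; rewrite cls_refl; apply/existsP; exists b; rewrite cls_refl.
Qed.

Lemma verticesP (X : {set 'rV[R]_m}) : reflect
  (exists a, [/\ red a != 0, qform G a = 0 & X = cls a]) (X \in vertices G).
Proof.
apply: (iffP imsetP) => [[a]|[a [a0 qa ->]]].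
  by rewrite inE admissibleE => /andP[a0 /eqP qa] ->; exists a.
by exists a; rewrite // inE admissibleE a0 qa eqxx.
Qed.

Lemma card_vertices_vectors (D : pred {set 'rV[R]_m}) (C : pred 'rV['F_2]_m) :
    (forall a, red a != 0 -> qform G a = 0 -> D (cls a) = C (red a)) ->
  (#|[set X in vertices G | D X]| * #|max_ideal|
     = #|[set a | [&& red a != 0%R, qform G a == 0%R & C (red a)]]|)%N.
Proof.
move=> DC; rewrite -[RHS]sum1_card.
rewrite (partition_big (@cls R m) (mem [set X in vertices G | D X])) /=; last first.
  move=> a; rewrite !inE => /and3P[a0 /eqP qa Ca]; rewrite DC // Ca andbT.
  by apply/verticesP; exists a.
rewrite -sum_nat_const; apply: eq_bigr => _ /setIdP[/verticesP[a [a0 qa ->]] Da].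
rewrite sum1dep_card -(@card_cls a) ?admissibleE //.
apply: eq_card => b; rewrite [in RHS]inE; apply/idP/andP=> [ab|[_ /eqP <-]].
  split; last by rewrite (cls_eq _ _ ab).
  rewrite inE (red_cls _ _ ab) a0 -DC // Da.
  by case/clsP: ab => l _ ->; rewrite qformZ qa mulr0 eqxx.
exact: cls_refl.
Qed.

(** Write K for the size of [max_ideal]. A fibre has K^m vectors, one in K of them is a zero, and a
    class holds K vectors, which leaves K^(m-2) classes above each binary zero. Vertex count, degree
    and common neighbours follow by choosing [D] and [C]. *)
Lemma card_vertices_residue (D : pred {set 'rV[R]_m}) (C : pred 'rV['F_2]_m) :
    (2 <= m)%N -> nonsingular_form _ (red G) ->
    (forall a, red a != 0 -> qform G a = 0 -> D (cls a) = C (red a)) ->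
  #|[set X in vertices G | D X]|
    = (#|[set p : 'rV['F_2]_m | [&& p != 0%R, qform (red G) p == 0%R & C p]]|
       * #|max_ideal| ^ (m - 2))%N.
Proof.
move=> m2 nsG /card_vertices_vectors; set P := [set p : 'rV['F_2]_m | _].
set N := #|_|; set A := [set a | _]; set K := #|_| => NK.
have K0 : (0 < K)%N by apply/card_gt0P; exists 0; rewrite inE rmorph0.
(* The same identity without division: substitute |A| = N K and |R| = 2 K, then cancel 2^m and
   K^2. *)
suff: (2 ^ m * (K * #|A|) = #|P| * #|R| ^ m)%N.
  rewrite -NK -card_max_ideal -/K expnMn [X in _ = X -> _]mulnCA => /eqP.
  rewrite eqn_pmul2l ?expn_gt0 //.
  have -> : (K ^ m = K ^ (m - 2) * K ^ 2)%N by rewrite -expnD subnK.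
  rewrite mulnA [(K * N)%N]mulnC.
  by rewrite -mulnA mulnn mulnA eqn_pmul2r ?expn_gt0 ?K0 // => /eqP.
have -> : #|A| = (\sum_(p in P) #|[set a | (red a == p) && (qform G a == 0%R)]|)%N.
  rewrite -[LHS]sum1_card (partition_big red (mem P)) /=; last first.
    move=> a; rewrite !inE => /and3P[-> /eqP qa ->].
    by rewrite qform_map qa rmorph0 eqxx.
  apply: eq_bigr => p; rewrite inE => /and3P[p0 qp Cp].
  rewrite sum1dep_card; apply: eq_card => a; rewrite !inE.
  by have [->|] := eqVneq (red a) p; rewrite ?andbF // p0 Cp !andbT.
rewrite !big_distrr -sum_nat_const; apply: eq_bigr => p; rewrite inE.
case/and3P=> p0 /eqP qp Cp /=.
by rewrite card_zeros_fiber ?card_red_fiber //; apply: nsG.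
Qed.

Hypotheses (m2 : (2 <= m)%N) (nsG : nonsingular_form _ (red G)).
Local Notation V := (vertices G).
Local Notation H := (red G).
Local Notation f := (#|max_ideal| ^ (m - 2))%N.

Lemma card_vertices_red :
  #|V| = (#|[set p | (p != 0%R) && (qform H p == 0%R)]| * f)%N.
Proof.
have := card_vertices_residue xpredT xpredT m2 nsG (fun _ _ _ => erefl).
rewrite (_ : [set X in V | _] = V); last by apply/setP=> X; rewrite inE andbT.
by move=> ->; congr (#|pred_of_set _| * _)%N; apply/setP=> p; rewrite !inE andbT.
Qed.

Lemma card_neighbours a :
  #|[set Y in V | adj G (cls a) Y]| = (#|zeros_nonorth _ H (red a)| * f)%N.
Proof.
rewrite (card_vertices_residue _ (fun p => bform H (red a) p != 0) m2 nsG) //.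
  congr (#|pred_of_set _| * _)%N; apply/setP=> p; rewrite !inE.
  by have [->|//] := eqVneq p 0; rewrite bform0r eqxx andbF.
by move=> b _ _; rewrite adj_cls.
Qed.

Lemma card_common_neighbours a b : common V (adj G) (cls a) (cls b)
  = (#|zeros_nonorth _ H (red a) :&: zeros_nonorth _ H (red b)| * f)%N.
Proof.
rewrite /common (card_vertices_residue _
  (fun p => (bform H (red a) p != 0) && (bform H (red b) p != 0)) m2 nsG) //.
  rewrite [zeros_nonorth _ _ _ :&: _]setI_sep; congr (_ * _)%N.
  apply: eq_card => p; rewrite !in_set.
  by have [->|//] := eqVneq p 0; rewrite bform0r eqxx !andbF.
by move=> c _ _; rewrite !adj_cls.
Qed.

(** With lifting factor 1 a single vertex lies above each binary zero. This rules out distinct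
    vertices with equal reduction when [nu = 1] and [delta = 0]. *)
Lemma eq_cls_of_red a b : f = 1%N -> red a = red b ->
  cls a \in V -> cls b \in V -> cls a = cls b.
Proof.
move=> f1 ab aV bV.
have := card_vertices_residue (fun X => [exists c in X, red c == red a])
  (pred1 (red a)) m2 nsG.
have /verticesP[a' [a'0 qa' ea]] := aV.
have ra : red a' = red a by apply/esym/red_cls; rewrite -ea cls_refl.
rewrite (_ : [set p | _] = [set red a]); last first.
  apply/setP=> p; rewrite !inE; have [->|] := eqVneq p (red a); last by rewrite !andbF.
  by rewrite -ra a'0 qform_map qa' rmorph0 eqxx.
rewrite cards1 f1 => cardX.
have /eqP/cards1P[X eX] : #|[set X in V | [exists c in X, red c == red a]]| = 1%N.
  apply: cardX => c _ _; apply/existsP/eqP=> [[d /andP[dc /eqP <-]]|ca].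
    by rewrite (red_cls _ _ dc).
  by exists c; rewrite cls_refl ca eqxx.
have inX c : cls c \in V -> red c = red a -> cls c = X.
  move=> cV ca; apply/set1P; rewrite -eX inE cV; apply/existsP.
  by exists c; rewrite cls_refl ca eqxx.
by rewrite (inX a) // (inX b).
Qed.

End Classes.
End ResidueF2.

(** * The form G and the ring Z/2^n *)

(** The exponent [n.+1] makes the modulus exceed 1, so that the type ['Z_] really has that many
    elements. *)
Definition Z2_residue (n : nat) (x : 'Z_(2 ^ n.+1)) : 'F_2 := (x : nat)%:R.

Section Z2Residue.
Variable n : nat.

Lemma Z2_gt1 : (1 < 2 ^ n.+1)%N.
Proof. by rewrite -{1}(expn0 2) ltn_exp2l. Qed.

Lemma natr_F2_modn (k : nat) : (k %% (Zp_trunc (2 ^ n.+1)).+2)%:R = k%:R :> 'F_2.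
Proof.
have d2 : (2 %| 2 ^ n.+1)%N by rewrite expnS dvdn_mulr.
by rewrite (Zp_cast Z2_gt1) -(Fp_nat_mod (isT : prime 2)) modn_dvdm ?Fp_nat_mod.
Qed.

Lemma Z2_residue_is_zmod_morphism : zmod_morphism (Z2_residue n).
Proof.
move=> x y; apply: (addIr (Z2_residue n y)); rewrite subrK.
rewrite /Z2_residue -natrD -[LHS]natr_F2_modn.
by rewrite -[X in X%:R]/(nat_of_ord (x - y + y)) subrK.
Qed.

Lemma Z2_residue_is_monoid_morphism : monoid_morphism (Z2_residue n).
Proof.
split=> [|x y]; first by rewrite /Z2_residue /= modn_small.
by rewrite /Z2_residue /= natr_F2_modn natrM.
Qed.

HB.instance Definition _ := GRing.isZmodMorphism.Build _ _ (Z2_residue n)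
  Z2_residue_is_zmod_morphism.
HB.instance Definition _ := GRing.isMonoidMorphism.Build _ _ (Z2_residue n)
  Z2_residue_is_monoid_morphism.

Lemma Z2_residue_unit (x : 'Z_(2 ^ n.+1)) : (x \is a GRing.unit) = (Z2_residue n x != 0).
Proof.
rewrite -{1}[x]natr_Zp unitZpE ?Z2_gt1 // coprime_pexpl // coprime2n.
by rewrite -val_eqE /= /Z2_residue val_Fp_nat // modn2 eqb0 negbK.
Qed.
End Z2Residue.

Lemma big_row_mx (R : finNzRingType) m k (F : 'rV[R]_(m + k) -> int) :
  \sum_p F p = \sum_x \sum_y F (row_mx x y).
Proof.
rewrite pair_bigA (reindex (fun u : 'rV[R]_m * 'rV[R]_k => row_mx u.1 u.2)) //=.
exists (fun p => (lsubmx p, rsubmx p)) => [[x y] _|p _] /=.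
  by rewrite row_mxKl row_mxKr.
by rewrite hsubmxK.
Qed.

Lemma sum_F2_rV0 (F : 'rV['F_2]_0 -> int) : \sum_w F w = F 0.
Proof.
rewrite (bigD1 0) //= big1 ?addr0 // => w.
by rewrite (thinmx0 w) eqxx.
Qed.

Lemma sum_F2_rV1 (F : 'rV['F_2]_1 -> int) : \sum_w F w = F 0 + F 1.
Proof.
rewrite (reindex (fun x : 'F_2 => const_mx x)) /=; last first.
  exists (fun w : 'rV_1 => w 0 0) => [x|w] _; rewrite ?mxE //.
  by apply/rowP=> i; rewrite !mxE ord1.
rewrite big_ord_recl big_ord1; congr (F _ + F _); apply/rowP=> i; rewrite !mxE //.
by rewrite (ord1 i); apply/val_inj.
Qed.

Definition Delta_mx (R : finComUnitRingType) (delta : nat) (z : R) : 'M[R]_delta :=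
  \matrix_(i, j) Delta delta z i j.

Section Blocks.
Variables (R : finComUnitRingType) (nu delta : nat) (z : R).
Local Notation D := (Delta_mx R delta z).

Lemma blocks_dim : (nu + nu + delta = 2 * nu + delta)%N.
Proof. by rewrite mul2n addnn. Qed.

(** Coordinates adapted to the blocks: [x] and [y] are paired with each other and [w] belongs to the
    block [Delta]. The cast reconciles nu + nu with 2 * nu. *)
Definition hyp_row (x y : 'rV[R]_nu) (w : 'rV[R]_delta) : 'rV[R]_(2 * nu + delta) :=
  castmx (erefl, blocks_dim) (row_mx (row_mx x y) w).

Lemma hyp_row_surj p : exists x y w, p = hyp_row x y w.
Proof.
pose p' := castmx (erefl, esym blocks_dim) p.
exists (lsubmx (lsubmx p')), (rsubmx (lsubmx p')), (rsubmx p').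
by rewrite /hyp_row !hsubmxK castmxKV.
Qed.

Lemma Gmat_blocks : Gmat nu delta z = castmx (blocks_dim, blocks_dim)
  (block_mx (block_mx 0 1%:M 0 0) 0 0 D).
Proof.
apply/matrixP=> i j; rewrite castmxE !mxE.
set i' := cast_ord _ i; set j' := cast_ord _ j.
have -> : nat_of_ord i = i' by []. have -> : nat_of_ord j = j' by [].
case: (splitP i') => k ->; rewrite mxE; case: (splitP j') => l ->; rewrite !mxE.
- have -> : (2 * nu <= k)%N = false by apply/negbTE; move: (ltn_ord k); lia.
  case: (splitP k) => k' ->; rewrite mxE; case: (splitP l) => l' ->; rewrite !mxE.
  + have -> : (l' == k' + nu :> nat)%N = false by apply/negbTE; move: (ltn_ord l'); lia.
    by rewrite andbF.
  + by rewrite /= addnC eqn_add2r eq_sym val_eqE; case: eqP.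
  + by [].
  + by [].
- have -> : (2 * nu <= k)%N = false by apply/negbTE; move: (ltn_ord k); lia.
  have -> : (k < nu)%N && (nu + nu + l == k + nu)%N = false by apply/negbTE; lia.
  by [].
- have -> : (2 * nu <= l)%N = false by apply/negbTE; move: (ltn_ord l); lia.
  have -> : (nu + nu + k < nu)%N = false by apply/negbTE; lia.
  by rewrite /= andbF.
- have -> : (nu + nu + k < nu)%N = false by apply/negbTE; lia.
  by rewrite mul2n -addnn !leq_addr !addKn.
Qed.

Lemma mulmx_cast3 m m' (e : m = m') (G : 'M[R]_m) (a b : 'rV[R]_m) :
  castmx (erefl, e) a *m castmx (e, e) G *m (castmx (erefl, e) b)^T = a *m G *m b^T.
Proof. by case: m' / e. Qed.

Lemma mulmx_Gmat x y w x' y' w' :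
  hyp_row x y w *m Gmat nu delta z *m (hyp_row x' y' w')^T
    = x *m y'^T + w *m D *m w'^T.
Proof.
rewrite Gmat_blocks mulmx_cast3 !mul_row_block !tr_row_mx !mul_row_col.
by rewrite !mulmx0 !addr0 add0r mulmx1 mul_row_col mul0mx !add0r.
Qed.

Lemma qform_Gmat x y w :
  qform (Gmat nu delta z) (hyp_row x y w) = (x *m y^T) 0 0 + qform D w.
Proof. by rewrite /qform mulmx_Gmat mxE. Qed.

Lemma bform_Gmat x y w x' y' w' :
  bform (Gmat nu delta z) (hyp_row x y w) (hyp_row x' y' w')
    = (x *m y'^T) 0 0 + (x' *m y^T) 0 0 + bform D w w'.
Proof. by rewrite !bformE !mulmx_Gmat !mxE addrACA. Qed.

End Blocks.

Lemma mulmx_tr_delta (R : comNzRingType) m (x : 'rV[R]_m) i :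
  (x *m (delta_mx 0 i : 'rV_m)^T) 0 0 = x 0 i.
Proof.
rewrite mxE (bigD1 i) //= big1 ?addr0 => [|j ji]; first by rewrite !mxE !eqxx mulr1.
by rewrite !mxE (negbTE ji) andbF mulr0.
Qed.

(** Orthogonality of the additive characters of F_2^m. *)
Lemma sum_F2_sign_dot m (x : 'rV['F_2]_m) :
  \sum_(y : 'rV_m) F2_sign ((x *m y^T) 0 0) = if x == 0 then 2 ^+ m else 0.
Proof.
have [->|/eqP x0] := eqVneq x 0.
  by rewrite -sum_F2_rV_const; apply: eq_bigr => y _; rewrite mul0mx mxE.
have [i xi] : exists i, x 0 i != 0.
  apply/existsP; apply: contra_notT x0; rewrite negb_exists => /forallP x0.
  by apply/rowP=> i; move: (x0 i); rewrite negbK mxE => /eqP.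
apply: (sum_F2_sign_morph _ (fun y : 'rV_m => (x *m y^T) 0 0) (delta_mx 0 i)).
  by move=> r s; rewrite linearD mulmxDr mxE.
by rewrite mulmx_tr_delta.
Qed.

(** * Gauss sum and nonsingularity of G over F_2 *)

Section AnisotropicBlock.

Lemma qform_Delta1 (w : 'rV['F_2]_1) : qform (Delta_mx _ 1 1) w = w 0 0.
Proof.
rewrite /qform !mxE !big_ord1 !mxE !big_ord1 !mxE /Delta /= mulr1.
by case: (F2P (w 0 0)) => ->; apply/val_inj.
Qed.

(** Squaring is the identity on F_2, so this is x^2 + xy + y^2, the norm form of F_4 over F_2. *)
Lemma qform_Delta2 (w : 'rV['F_2]_2) :
  qform (Delta_mx _ 2 1) w = w 0 0 + w 0 0 * w 0 1 + w 0 1.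
Proof.
rewrite /qform !mxE !big_ord_recl big_ord0 !mxE !big_ord_recl !big_ord0 !mxE /Delta /=.
have -> : lift ord0 ord0 = 1 :> 'I_2 by apply/val_inj.
by case: (F2P (w 0 0)) => ->; case: (F2P (w 0 1)) => ->; apply/val_inj.
Qed.

Lemma Delta_anisotropic delta (w : 'rV['F_2]_delta) : (delta <= 2)%N ->
  qform (Delta_mx _ delta 1) w = 0 -> w = 0.
Proof.
case: delta w => [|[|[|//]]] w _; first by rewrite (thinmx0 w).
  by rewrite qform_Delta1 => w0; apply/rowP=> i; rewrite (ord1 i) mxE.
rewrite qform_Delta2 => qw; apply/rowP=> i; rewrite mxE.
have : (w 0 0 == 0) && (w 0 1 == 0).
  by move: qw; case: (F2P (w 0 0)) => ->; case: (F2P (w 0 1)) => ->.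
case/andP=> /eqP w0 /eqP w1.
case: i => -[|[|//]] lt; [rewrite -[RHS]w0 | rewrite -[RHS]w1].
  by congr (w _ _); apply/val_inj.
by congr (w _ _); apply/val_inj.
Qed.

(** By anisotropy the zero vector contributes 1 and each of the other 2^delta - 1 vectors
    contributes -1. *)
Lemma gauss_sum_Delta delta : (delta <= 2)%N ->
  gauss_sum _ (Delta_mx _ delta 1) = 2 - 2 ^+ delta.
Proof.
rewrite /gauss_sum; case: delta => [|[|[|//]]] _.
- by rewrite sum_F2_rV0 /qform !mul0mx mxE.
- by rewrite sum_F2_rV1 !qform_Delta1 !mxE.
rewrite (big_row_mx _ 1 1) !sum_F2_rV1 !qform_Delta2.
have El (x y : 'rV['F_2]_1) : (row_mx x y : 'rV_2) 0 0 = x 0 0.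
  by rewrite mxE; case: splitP => j // _; rewrite (ord1 j).
have Er (x y : 'rV['F_2]_1) : (row_mx x y : 'rV_2) 0 1 = y 0 0.
  by rewrite mxE; case: splitP => j //; rewrite (ord1 j).
by rewrite !El !Er !mxE.
Qed.

Variables (nu delta : nat).
Hypothesis delta_le2 : (delta <= 2)%N.
Local Notation H := (Gmat nu delta (1 : 'F_2)).

(** The sum factors along the blocks. In the hyperbolic part, summing over [y] kills every [x]
    except 0, which leaves 2^nu. *)
Lemma gauss_sum_Gmat : gauss_sum _ H = 2 ^+ nu * (2 - 2 ^+ delta).
Proof.
rewrite -gauss_sum_Delta // /gauss_sum.
rewrite (reindex (fun p : 'rV_(nu + nu + delta) =>
  castmx (erefl, blocks_dim nu delta) p)) /=; last first.
  exists (castmx (esym (erefl 1%N), esym (blocks_dim nu delta))) => p _.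
    by rewrite castmxK.
  by rewrite castmxKV.
transitivity (\sum_(x : 'rV['F_2]_nu) \sum_(y : 'rV['F_2]_nu) \sum_w
    F2_sign ((x *m y^T) 0 0) * F2_sign (qform (Delta_mx _ delta 1) w)).
  rewrite !big_row_mx; apply: eq_bigr => x _; apply: eq_bigr => y _.
  apply: eq_bigr => w _.
  by rewrite -/(hyp_row _ _ _ x y w) qform_Gmat F2_signD.
have Ex (x : 'rV['F_2]_nu) : \sum_(y : 'rV['F_2]_nu) \sum_w
      F2_sign ((x *m y^T) 0 0) * F2_sign (qform (Delta_mx _ delta 1) w)
    = (if x == 0 then 2 ^+ nu else 0)
      * \sum_w F2_sign (qform (Delta_mx _ delta 1) w).
  rewrite -sum_F2_sign_dot mulr_suml; apply: eq_bigr => y _.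
  by rewrite mulr_sumr.
rewrite (eq_bigr _ (fun x _ => Ex x)).
by rewrite -mulr_suml (bigD1 0) //= eqxx big1 ?addr0 // => x /negbTE ->.
Qed.

(** A nonzero coordinate of [x] or [y] is detected by the dual hyperbolic basis vector. If there is
    none, the vector lies in the anisotropic block, where singular means zero. *)
Lemma nonsingular_Gmat : nonsingular_form _ H.
Proof.
move=> p; have [x [y [w ->]]] := hyp_row_surj _ _ _ p.
move=> p0 qp.
have [/existsP[i xi]|] := boolP [exists i, x 0 i != 0].
  exists (hyp_row _ _ _ 0 (delta_mx 0 i) 0).
  by rewrite bform_Gmat mulmx_tr_delta mul0mx bform0r mxE !addr0.
have [/existsP[i yi]|] := boolP [exists i, y 0 i != 0].
  move=> _; exists (hyp_row _ _ _ (delta_mx 0 i) 0 0).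
  rewrite bform_Gmat bform0r trmx0 mulmx0 mxE add0r addr0.
  by rewrite -[delta_mx 0 i]trmxK -trmx_mul mxE mulmx_tr_delta.
rewrite !negb_exists => /forallP y0 /forallP x0.
have {}y0 : y = 0 by apply/rowP=> i; move: (y0 i); rewrite negbK mxE => /eqP.
have {}x0 : x = 0 by apply/rowP=> i; move: (x0 i); rewrite negbK mxE => /eqP.
case/negP: p0; move: qp; rewrite qform_Gmat x0 y0 mul0mx mxE add0r.
move=> /Delta_anisotropic -> //.
by rewrite /hyp_row !row_mx0 castmx_const.
Qed.
End AnisotropicBlock.

Lemma map_Gmat (R S : finComUnitRingType) (f : {rmorphism R -> S}) nu delta z :
  map_mx f (Gmat nu delta z) = Gmat nu delta (f z).
Proof.
apply/matrixP=> i j; rewrite !mxE.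
by rewrite /Delta; do ?[case: ifP => _ | rewrite rmorph1 | rewrite rmorph0].
Qed.

(** * Intersection numbers of the binary graph *)

Section BinaryCounts.
Variables (m delta : nat).
Hypothesis delta_le2 : (delta <= 2)%N.
Local Notation nu := m.+1.
Local Notation H := (Gmat nu delta (1 : 'F_2)).
Implicit Types p r : 'rV['F_2]_(2 * nu + delta).

Lemma exp2_dim :
  (2 : int) ^+ (2 * nu + delta) = (4 * (2 ^ m * 2 ^ m * 2 ^ delta))%N%:Z.
Proof.
have -> : (2 * nu + delta = 2 + (m + m + delta))%N by lia.
by rewrite -natz -!expnD natrM natrX exprD.
Qed.

Lemma gauss_sum_dim :
  gauss_sum _ H = (2 * 2 ^ m)%N%:Z * (2 - (2 ^ delta)%N%:Z).
Proof.
rewrite gauss_sum_Gmat //; congr (_ * (_ - _)); last by rewrite -natz natrX.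
by rewrite -natz natrM natrX exprS.
Qed.

Lemma card_nonzero_zeros :
  #|[set p | (p != 0%R) && (qform H p == 0%R)]|
    = ((2 ^ nu - 1) * (2 ^ (nu + delta - 1) + 1))%N.
Proof.
have := card_zeros _ H; rewrite gauss_sum_dim exp2_dim.
have -> : [set p | qform H p == 0] = 0 |: [set p | (p != 0%R) && (qform H p == 0%R)].
  apply/setP=> p; rewrite !inE; have [->|//] := eqVneq p 0.
  by rewrite /qform !mul0mx mxE eqxx.
rewrite cardsU1 !inE eqxx /= natz; move: #|_| => c.
have -> : (nu + delta - 1 = m + delta)%N by lia.
rewrite expnD expnS; have : (0 < 2 ^ m)%N by rewrite expn_gt0.
(* The hypothesis reads c + 1 = 2 w^2 d + 2 w - w d, which is (2 w - 1)(w d + 1) + 1. *)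
by move: (2 ^ m)%N (2 ^ delta)%N => w d w0 E; nia.
Qed.

Lemma card_zeros_nonorth_Gmat p : p != 0 -> qform H p = 0 ->
  #|zeros_nonorth _ H p| = (2 ^ (2 * nu + delta - 2))%N.
Proof.
move=> p0 qp; have [y py] := nonsingular_Gmat _ _ delta_le2 p p0 qp.
have := card_zeros_nonorth _ _ p y qp py; rewrite exp2_dim natz.
have -> : (2 * nu + delta - 2 = m + m + delta)%N by lia.
by rewrite !expnD; lia.
Qed.

(** The sign of b(p,p') is -1, so the Gauss sum enters with coefficient -2. The form of the equation
    avoids halving and truncated subtraction. *)
Lemma card_zeros_nonorth2_adj p p' : p != 0 -> p' != 0 -> qform H p = 0 ->
    qform H p' = 0 -> bform H p p' != 0 ->
  (2 * #|zeros_nonorth _ H p :&: zeros_nonorth _ H p'| + 2 ^ nu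
    = 2 ^ (2 * m + delta) + 2 ^ (m + delta))%N.
Proof.
move=> p0 p'0 qp qp' bpp.
have pp' : p != p'.
  by apply: contraNneq bpp => ->; rewrite bform_diag qp' mul0rn.
have := card_zeros_nonorth2 _ _ p p' (nonsingular_Gmat _ _ delta_le2) p0 p'0 pp' qp qp'.
have -> : F2_sign (bform H p p') = -1 by rewrite /F2_sign (negbTE bpp).
rewrite exp2_dim gauss_sum_dim natz; move: #|_| => c E.
have -> : (2 * m + delta = m + m + delta)%N by lia.
move: E; rewrite !expnD expnS; move: (2 ^ m)%N (2 ^ delta)%N => w d; nia.
Qed.

Lemma card_zeros_nonorth2_nonadj p p' : p != 0 -> p' != 0 -> p != p' ->
    qform H p = 0 -> qform H p' = 0 -> bform H p p' = 0 ->
  (2 * #|zeros_nonorth _ H p :&: zeros_nonorth _ H p'| = 2 ^ (2 * m + delta))%N.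
Proof.
move=> p0 p'0 pp' qp qp' bpp.
have := card_zeros_nonorth2 _ _ p p' (nonsingular_Gmat _ _ delta_le2) p0 p'0 pp' qp qp'.
have -> : F2_sign (bform H p p') = 1 by rewrite /F2_sign bpp.
rewrite exp2_dim gauss_sum_dim natz; move: #|_| => c E.
have -> : (2 * m + delta = m + m + delta)%N by lia.
move: E; rewrite !expnD; move: (2 ^ m)%N (2 ^ delta)%N => w d; nia.
Qed.

(** There are only 2^delta + 1 nonzero singular vectors, and 2^delta of them are non-orthogonal to
    [p]. Were [p'] orthogonal to [p], then [p] and [p'] would bring the total to 2^delta + 2. *)
Lemma nonorth_of_rank1 p p' : m = 0%N -> p != 0 -> p' != 0 -> p != p' ->
  qform H p = 0 -> qform H p' = 0 -> bform H p p' != 0.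
Proof.
move=> m0 p0 p'0 pp' qp qp'; apply/negP=> /eqP bpp.
have := card_nonzero_zeros; have := card_zeros_nonorth_Gmat _ p0 qp.
have : p |: (p' |: zeros_nonorth _ H p)
    \subset [set r | (r != 0%R) && (qform H r == 0%R)].
  apply/subsetP=> r; rewrite !inE => /or3P[/eqP->|/eqP->|/andP[qr br]].
  - by rewrite p0 qp eqxx.
  - by rewrite p'0 qp' eqxx.
  rewrite qr andbT; apply: contraNneq br => ->; by rewrite bform0r.
move/subset_leq_card; rewrite !cardsU1 !inE (negbTE pp') bform_diag qp mul0rn bpp.
rewrite eqxx !andbF /= => le cn ca; move: le; rewrite ca cn m0 => {ca cn}.
have -> : (2 * 1 + delta - 2 = delta)%N by lia.
have -> : (1 + delta - 1 = delta)%N by lia.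
by move: (2 ^ delta)%N => d; lia.
Qed.

End BinaryCounts.

(** * The orthogonal graph *)

Section OrthogonalGraph.
Variables (R : finComUnitRingType) (rho : {rmorphism R -> 'F_2}).
Hypothesis unit_res : forall x, (x \is a GRing.unit) = (rho x != 0).
Variables (n m delta : nat) (z : R).
Hypotheses (cardR : #|R| = (2 ^ n.+1)%N) (delta_le2 : (delta <= 2)%N).
Hypothesis unit_z : z \is a GRing.unit.
Local Notation nu := m.+1.
Local Notation G := (Gmat nu delta z).
Local Notation V := (vertices G).
Local Notation e := (adj G).
Local Notation red := (map_mx rho).
Local Notation f := (2 ^ (n * (2 * m + delta)))%N.

Lemma red_Gmat : red G = Gmat nu delta 1.
Proof.
by rewrite map_Gmat; congr Gmat; move: unit_z; rewrite unit_res F2_neq0 => /eqP.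
Qed.

Lemma lift_factor : (#|max_ideal R rho| ^ (2 * nu + delta - 2) = f)%N.
Proof.
have /eqP := card_max_ideal _ rho unit_res.
rewrite cardR expnS eqn_pmul2l // => /eqP ->; rewrite -expnM.
by congr (2 ^ (n * _))%N; lia.
Qed.

Lemma dim_ge2 : (2 <= 2 * nu + delta)%N. Proof. by lia. Qed.

Lemma nonsingular_red : nonsingular_form _ (red G).
Proof. by rewrite red_Gmat; apply: nonsingular_Gmat. Qed.

Lemma vertexP X : X \in V ->
  exists a, [/\ red a != 0, qform (red G) (red a) = 0 & X = cls a].
Proof.
case/(verticesP _ rho unit_res) => a [a0 qa ->]; exists a; split=> //.
by rewrite qform_map qa rmorph0.
Qed.

Lemma card_orthogonal_graph :
  #|V| = (f * (2 ^ nu - 1) * (2 ^ (nu + delta - 1) + 1))%N.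
Proof.
rewrite (card_vertices_red _ rho unit_res _ _ dim_ge2 nonsingular_red) lift_factor.
by rewrite red_Gmat card_nonzero_zeros // mulnC mulnA.
Qed.

Lemma orthogonal_graph_regular : regular V e (2 ^ (n.+1 * (2 * m + delta)))%N.
Proof.
move=> X /vertexP[a [a0 qa ->]].
rewrite (card_neighbours _ rho unit_res _ _ dim_ge2 nonsingular_red) lift_factor.
move: qa; rewrite red_Gmat => qa; rewrite card_zeros_nonorth_Gmat // -expnD.
by congr (2 ^ _)%N; lia.
Qed.

Lemma common_adjacent X Y : X \in V -> Y \in V -> e X Y ->
  (2 * common V e X Y + 2 ^ nu * f = (2 ^ (2 * m + delta) + 2 ^ (m + delta)) * f)%N.
Proof.
move=> /vertexP[a [a0 qa ->]] /vertexP[b [b0 qb ->]].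
rewrite (adj_cls _ rho unit_res) => ab.
rewrite (card_common_neighbours _ rho unit_res _ _ dim_ge2 nonsingular_red) lift_factor.
move: ab qa qb; rewrite red_Gmat => ab qa qb.
by rewrite -(card_zeros_nonorth2_adj _ _ delta_le2 _ _ a0 b0 qa qb ab) mulnDl mulnA.
Qed.

(** Either the reductions are distinct orthogonal vectors, or they agree and every neighbour of [X]
    is one of [Y], so the count is the degree. The side conditions tell which case survives when
    [nu = 1]. *)
Lemma common_nonadjacent X Y : X \in V -> Y \in V -> X != Y -> ~~ e X Y ->
  [\/ (2 * common V e X Y = 2 ^ (2 * m + delta) * f)%N /\ (0 < m)%N |
      common V e X Y = (2 ^ (n.+1 * (2 * m + delta)))%N /\ (0 < 2 * m + delta)%N].
Proof.
move=> XV YV; have [a [a0 qa eX]] := vertexP _ XV; have [b [b0 qb eY]] := vertexP _ YV.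
rewrite {}eX {}eY in XV YV *; move=> neq.
rewrite (adj_cls _ rho unit_res) negbK => /eqP ab.
rewrite (card_common_neighbours _ rho unit_res _ _ dim_ge2 nonsingular_red) lift_factor.
have [rab|rab] := eqVneq (red a) (red b).
  right; split.
    move: qb; rewrite rab setIid red_Gmat => qb.
    by rewrite card_zeros_nonorth_Gmat // -expnD; congr (2 ^ _)%N; lia.
  rewrite lt0n; apply: contraNneq neq => d0; apply/eqP.
  apply: (eq_cls_of_red _ rho unit_res _ _ dim_ge2 nonsingular_red) => //.
  by rewrite lift_factor d0 muln0.
left; move: qa qb ab; rewrite red_Gmat => qa qb ab; split.
  by rewrite mulnA card_zeros_nonorth2_nonadj.
rewrite lt0n; apply/eqP => m0.
have := nonorth_of_rank1 _ _ delta_le2 _ _ m0 a0 b0 rab qa qb.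
by rewrite ab eqxx.
Qed.

End OrthogonalGraph.

(** * Closed forms of the parameters *)

Lemma natr_lambda (n m delta lam : nat) : (delta <= 2)%N -> (0 < m)%N ->
  (2 * lam + 2 ^ m.+1 = 2 ^ (2 * m + delta) + 2 ^ (m + delta))%N ->
  (lam * 2 ^ (n * (2 * m + delta)))%:R
    = (2 ^ n)%:R
      * (sqrtC 2 ^+ (n.+1 * (2 * m.+1 - 2 + delta))
         + (delta%:R - 1) * sqrtC 2 ^+ (n * (2 * m.+1 - 2 + delta)))
      * sqrtC 2 ^+ (n.+1 * (2 * m.+1 - 4 + delta)) :> algC.
Proof.
case: m => // m d2 _.
have -> : (2 * m.+2 - 2 + delta = 2 * m + delta + 2)%N by lia.
have -> : (2 * m.+2 - 4 + delta = 2 * m + delta)%N by lia.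
rewrite mulnC => /(congr1 (fun j => j%:R : algC)).
rewrite natrD [in RHS]natrD (natrM _ lam 2) (natrM _ lam (2 ^ _)).
have s2 : sqrtC (2 : algC) ^+ 2 = 2 by exact: sqrtCK.
move: (sqrtC 2) s2 => s s2.
have pow2 j : (2 ^ j)%:R = s ^+ (2 * j) :> algC by rewrite natrX exprM s2.
(* The Gauss sum carries the factor 2 - 2^delta, the stated lambda carries delta - 1. *)
have sD : (delta%:R - 1) * s ^+ delta = s ^+ (2 * delta) - 2.
  case: delta d2 => [|[|[|//]]] _.
  - by rewrite muln0 !expr0; ring.
  - by rewrite subrr mul0r s2 subrr.
  - by rewrite (exprM s 2 2) s2; ring.
rewrite !pow2 => /(canRL (addrK _)) lamE.
(* Only twice [lam] is known, so both sides are first multiplied by 2 = s^2. *)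
apply: (mulfI (x := s ^+ 2)); first by rewrite s2 pnatr_eq0.
rewrite mulrA {1}s2 [2 * _]mulrC lamE.
(* The exponents contain the products n m and n delta; storing these in [t] turns every power of [s]
   into a monomial in [t], [w], [u], [d] and [s]. *)
pose t := s ^+ (n * (2 * m + delta)); pose w := s ^+ m; pose u := s ^+ n.
pose d := s ^+ delta.
have e1 : s ^+ (2 * (2 * m.+1 + delta)) = s ^+ 4 * w ^+ 4 * d ^+ 2.
  by rewrite /t /w /u /d -!exprM -!exprD; congr (_ ^+ _); lia.
have e2 : s ^+ (2 * (m.+1 + delta)) = s ^+ 2 * w ^+ 2 * d ^+ 2.
  by rewrite /t /w /u /d -!exprM -!exprD; congr (_ ^+ _); lia.
have e3 : s ^+ (2 * m.+2) = s ^+ 4 * w ^+ 2.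
  by rewrite /t /w /u /d -!exprM -!exprD; congr (_ ^+ _); lia.
have e4 : s ^+ (2 * (n * (2 * m.+1 + delta))) = t ^+ 2 * u ^+ 4.
  by rewrite /t /w /u /d -!exprM -!exprD; congr (_ ^+ _); lia.
have e5 : s ^+ (n.+1 * (2 * m + delta + 2)) = t * u ^+ 2 * w ^+ 2 * d * s ^+ 2.
  by rewrite /t /w /u /d -!exprM -!exprD; congr (_ ^+ _); lia.
have e6 : s ^+ (n * (2 * m + delta + 2)) = t * u ^+ 2.
  by rewrite /t /w /u /d -!exprM -!exprD; congr (_ ^+ _); lia.
have e7 : s ^+ (n.+1 * (2 * m + delta)) = t * w ^+ 2 * d.
  by rewrite /t /w /u /d -!exprM -!exprD; congr (_ ^+ _); lia.
have e8 : s ^+ (2 * n) = u ^+ 2 by rewrite mulnC exprM.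
rewrite e1 e2 e3 e4 e5 e6 e7 e8.
have sD' : (delta%:R - 1) * d = d ^+ 2 - 2.
  by rewrite sD -!exprM mulnC.
rewrite -[RHS](_ : u ^+ 4 * t ^+ 2 * w ^+ 2 * s ^+ 2 *
  (w ^+ 2 * d ^+ 2 * s ^+ 2 + (delta%:R - 1) * d) = _); last by ring.
rewrite sD' -[4%N]/(2 * 2)%N !(exprM s 2) s2; ring.
Qed.

(** Compares the exponents of 2 in twice c_1 and in twice the count for distinct reductions; m > 0
    keeps 2 nu - 3 from truncating. *)
Lemma nonadjacent_exponent (n m delta : nat) : (0 < m)%N ->
  (n.+1 + n.+1 * (2 * m.+1 - 3 + delta) = 2 * m + delta + n * (2 * m + delta))%N.
Proof.
case: m => // m _; have -> : (2 * m.+2 - 3 + delta = 2 * m + delta + 1)%N by lia.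
lia.
Qed.

Theorem theorem2p3 (n nu delta : nat) (z : 'Z_(2 ^ n)) :
  (1 <= n)%N -> (1 <= nu)%N -> (delta <= 2)%N -> z \is a GRing.unit ->
  let G := Gmat nu delta z in
  let V := vertices G in
  let e := adj G in
  let k := (2 ^ (n * (2 * nu + delta - 2)))%N in
  let v := (2 ^ ((n - 1) * (2 * nu + delta - 2)) * (2 ^ nu - 1)
              * (2 ^ (nu + delta - 1) + 1))%N in
  [/\ #|V| = v, regular V e k,
      (nu = 1%N ->
         strongly_regular V e v k
           (2 ^ (delta * n) - 2 ^ (delta * (n - 1)))%N
           ((delta + 1) %/ 2 * 2 ^ (delta * n))%N) &
      (2 <= nu)%N ->
         exists lam : nat,
           (lam%:R : algC) =
             (2 ^ (n - 1))%:R
             * ((sqrtC 2) ^+ (n * (2 * nu - 2 + delta))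
                + (delta%:R - 1) * (sqrtC 2) ^+ ((n - 1) * (2 * nu - 2 + delta)))
             * (sqrtC 2) ^+ (n * (2 * nu - 4 + delta))
           /\ quasi_strongly_regular V e v k lam
                [:: (2 ^ (n - 1) * 2 ^ (n * (2 * nu - 3 + delta)))%N;
                    (2 ^ (n * (2 * nu - 2 + delta)))%N]].
Proof.
case: n z => // n z _; case: nu => // m _ d2 uz G V e k v.
pose R := 'Z_(2 ^ n.+1) : finComUnitRingType.
pose rho := Z2_residue n : {rmorphism R -> 'F_2}.
have unit_res : forall x : R, (x \is a GRing.unit) = (rho x != 0) := Z2_residue_unit n.
have cardR : #|R| = (2 ^ n.+1)%N by rewrite card_ord (Zp_cast (Z2_gt1 n)).
have dimE : (2 * m.+1 + delta - 2 = 2 * m + delta)%N by lia.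
have n1 : (n.+1 - 1 = n)%N by rewrite subn1.
have cardV : #|V| = v.
  by rewrite /v (card_orthogonal_graph R rho unit_res n m delta z) // dimE n1.
have regV : regular V e k.
  have := orthogonal_graph_regular R rho unit_res n m delta z cardR d2 uz.
  by rewrite /k dimE.
have adjV := common_adjacent R rho unit_res n m delta z cardR d2 uz.
have nadjV := common_nonadjacent R rho unit_res n m delta z cardR d2 uz.
rewrite -/G -/V -/e in adjV nadjV.
clearbody V e; clear rho unit_res cardR uz.
split=> // [[m0] | m1].
  have {}m0 : m = 0%N by lia.
  have fE : (n * (2 * m + delta) = delta * n)%N by rewrite m0; lia.
  split=> // X Y XV YV nXY.
    move/(adjV _ _ XV YV); move: (common _ _ _ _) => w; rewrite fE.
    have -> : (delta * n.+1 = delta + delta * n)%N by lia.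
    rewrite n1 m0 muln0 !add0n expnD expn1.
    by move: (2 ^ delta)%N (2 ^ (delta * n))%N => c u; nia.
  (* For [nu = 1] only equal reductions remain, and they force delta > 0, where the ceiling of
     delta/2 is 1. For [delta = 0] no such pair exists. *)
  move=> /(nadjV _ _ XV YV nXY)[] [E d0]; first by rewrite m0 in d0.
  have dgt0 : (0 < delta)%N by rewrite m0 in d0.
  rewrite E.
  have -> : ((delta + 1) %/ 2 = 1)%N by lia.
  by rewrite mul1n m0; congr (2 ^ _)%N; lia.
(* The binary count for adjacent vectors, solved for by halving, times the lifting factor. *)
exists ((2 ^ (2 * m + delta - 1) + 2 ^ (m + delta - 1) - 2 ^ m)
        * 2 ^ (n * (2 * m + delta)))%N.
set lam0 := (_ - _)%N.
have lam0E : (2 * lam0 + 2 ^ m.+1 = 2 ^ (2 * m + delta) + 2 ^ (m + delta))%N.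
  (* This bound, valid since m > 0, makes the truncated subtraction in [lam0] exact. *)
  have le : (2 ^ m <= 2 ^ (2 * m + delta - 1))%N by rewrite leq_exp2l //; lia.
  rewrite /lam0.
  have -> : (2 * m + delta = (2 * m + delta - 1).+1)%N by lia.
  have -> : (m + delta = (m + delta - 1).+1)%N by lia.
  by rewrite !subn1 /= !expnS in le *; lia.
split.
  by rewrite n1; apply: natr_lambda.
split=> // X Y XV YV nXY.
  move/(adjV _ _ XV YV); rewrite -lam0E; move: (common _ _ _ _) => w.
  by move: lam0 (2 ^ m.+1)%N (2 ^ (n * _))%N {lam0E} => l c u; nia.
rewrite !inE => /(nadjV _ _ XV YV nXY)[] [E _].
  apply/orP; left; rewrite -(eqn_pmul2l (isT : 0 < 2)%N) E n1 mulnA -expnS -!expnD.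
  by rewrite nonadjacent_exponent.
have -> : (2 * m.+1 - 2 + delta = 2 * m + delta)%N by lia.
by rewrite E eqxx orbT.
Qed.
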